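(* Let $(X,Y,c=\langle\cdot,\cdot\rangle)$ be a dual system, $Z:=X\times Y$, let $G\subset Z$ be non-empty, and let $S\subset Z$ be non-empty, dissipative, convex, and $\sigma(Z,G\cup S)$-compact. Then $$\min_{S}(\varphi_{G}-c)=\sup_{g\in\operatorname{conv}G}\ \min_{s\in S}\bigl(s\cdot g-(\operatorname{conv}c_{G})(g)-c(s)\bigr),$$ and the following three conditions are equivalent: (1) $G^{+}\cap S\neq\emptyset$; (2) $\min_{S}(\varphi_{G}-c)\le 0$; (3) for every $g\in\operatorname{conv}G$ there exists $s\in S$ such that $$(\operatorname{conv}c_{G}-c)(g)+c(g-s)=(\operatorname{conv}c_{G})(g)+c(s)-s\cdot g\ \ge 0.$$
   Context: A dual system $(X,Y,c=\langle\cdot,\cdot\rangle)$ consists of real vector spaces $X,Y$ and a bilinear form $\langle\cdot,\cdot\rangle:X\times Y\to\mathbb{R}$; no separation is assumed. Put $Z:=X\times Y$ and $c(x,y):=\langle x,y\rangle$; for $z=(x,y)$, $w=(u,v)$ in $Z$, $z\cdot w:=\langle x,v\rangle+\langle u,y\rangle$. For $\emptyset\neq B\subset Z$, $\sigma(Z,B)$ is the weakest topology on $Z$ making all linear forms $z\mapsto z\cdot b$, $b\in B$, continuous (it need not be Hausdorff). A set $S\subset Z$ is dissipative if $c(s_1-s_2)\le 0$ for all $s_1,s_2\in S$. $G^{+}:=\{z\in Z\mid c(z-g)\ge 0\ \text{for all } g\in G\}$ is the set of points monotonically related to $G$; $G$ itself is not assumed monotone. $\operatorname{conv}G$ is the convex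 hull of $G$. $c_G:Z\to\mathbb{R}\cup\{+\infty\}$ equals $c$ on $G$ and $+\infty$ off $G$. $\operatorname{conv}c_G:Z\to[-\infty,+\infty]$ is the convex hull of $c_G$, i.e. the greatest convex function not exceeding $c_G$. $\varphi_G(z):=\sup_{g\in G}(z\cdot g-c(g))$, $z\in Z$, is the Fitzpatrick function of $G$. Conventions: $\inf\emptyset=+\infty$, $\sup\emptyset=-\infty$, $\infty-\infty=\infty$. ''$\min$'' means that the infimum is finite and attained.
   Formalization: In the displayed equality ''min'' means attained and never −∞, but possibly +∞, instead of finite and attained: for X=Y=ℝ, ⟨x,y⟩=xy, G=Z, S={0} both sides are +∞. Condition (2) still requires a finite attained minimum. *)

(* Defs.v *)
From HB Require Import structures.
From mathcomp Require Import all_boot all_order all_algebra sesquilinear.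
From mathcomp Require Import all_classical all_reals.
From mathcomp Require Import ereal topology convex.

Set Implicit Arguments.
Unset Strict Implicit.
Unset Printing Implicit Defensive.

Import Order.TTheory GRing.Theory Num.Theory.

Local Open Scope classical_set_scope.
Local Open Scope ring_scope.

Section DualSystem.
Context {R : realType} {X Y : lmodType R} (br : {bilinear X -> Y -> R^o}).
Local Notation Z := (X * Y)%type.
Implicit Types (z w g s : Z) (A B G S : set Z).

Definition cpl z : R := br z.1 z.2.

Definition dot z w : R := br z.1 w.2 + br w.1 z.2.

(* As a type this is Z; its topology is the supremum of the topologies
   induced by the single forms z |-> dot z b, b in B. *)
Definition sigma_topology B : Type :=
  @sup_topology Z (set_type B)
    (fun b => Topological.on
       (initial_topology (fun z => dot z (set_val b) : R^o))).
HB.instance Definition _ B := Topological.on (sigma_topology B).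

Definition sigma_compact B S := @compact (sigma_topology B) S.

Definition dissipative S :=
  forall s1 s2, S s1 -> S s2 -> cpl (s1 - s2) <= 0.

Definition mono_polar G : set Z :=
  [set z | forall g, G g -> 0 <= cpl (z - g)].

Definition cpl_on G z : \bar R := if z \in G then (cpl z)%:E else +oo%E.

Definition fitzpatrick G z : \bar R :=
  ereal_sup [set (dot z g - cpl g)%:E | g in G].

End DualSystem.

Section Convexity.
Context {R : realType} {E : lmodType R}.
Implicit Types (f h : E -> \bar R) (A : set E).

Definition conv_set A : set E := smallest (@convex_set R E) A.

(* Convexity of a [-oo, +oo]-valued function, as convexity of its epigraph;
   this is Jensen's inequality under the convention oo - oo = +oo, whereas
   adde evaluates oo - oo to -oo. *)
Definition econvex f :=
  @convex_set R (E * R^o)%type [set p : E * R^o | (f p.1 <= (p.2 : R)%:E)%E].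

(* Greatest convex minorant: the epigraph of a pointwise supremum is the
   intersection of the epigraphs, so this supremum is itself convex. *)
Definition conv_fun f x : \bar R :=
  ereal_sup [set h x | h in
    [set h : E -> \bar R | econvex h /\ forall y, (h y <= f y)%E]].

End Convexity.

Section Minimum.
Context {R : realType} {T : Type}.
Implicit Types (S : set T) (f : T -> \bar R).

Definition inf_on S f : \bar R := ereal_inf (f @` S).

(* The minimum is never -oo; it may be +oo only when f is +oo on all of S. *)
Definition attains_min S f :=
  exists2 s0, S s0 & (-oo < f s0)%E /\ forall s, S s -> (f s0 <= f s)%E.

End Minimum.

(* Main.v *)
(* On a dissipative S, -c(z) = max_(s in S) (c(s) - z . s), so that -c is convex
   and lower semicontinuous on S; therefore both phi_G - c and, for g in conv G,
   s |-> s . g - (conv c_G)(g) - c(s) attain their minima on S. The inequality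
   >= in the minimax formula holds because every affine minorant
   z |-> s . z - phi_G(s) of c_G also minorizes conv c_G. Conversely, if
   phi_G - c > lambda on S then each s in S lies in a relatively open set where
   s . g - c(g) - c(s) > lambda for some fixed g in G; compactness and the
   alternative for two convex functions, applied once for each set of the
   cover, merge these g into a single convex combination of points (g, c(g)),
   which lies in the epigraph of conv c_G. *)
Require Import Defs.
From HB Require Import structures.
From mathcomp Require Import all_boot all_order all_algebra sesquilinear.
From mathcomp Require Import all_classical all_reals.
From mathcomp Require Import ereal topology convex.
From mathcomp Require Import interval_inference normedtype ring lra.

Set Implicit Arguments.
Unset Strict Implicit.
Unset Printing Implicit Defensive.

Import Order.TTheory GRing.Theory Num.Theory.

Local Open Scope classical_set_scope.
Local Open Scope ring_scope.
Local Open Scope ereal_scope.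

(** * Compactness: cover induction and attained minima *)

(** If [P] fails on [K], the sets whose complement in [K] satisfies [P] form a proper filter
    containing [K]; a cluster point of it in [K] contradicts the local hypothesis. *)
Lemma compact_cover_ind (T : topologicalType) (K : set T) (P : set T -> Prop) :
  compact K -> P set0 ->
  (forall A B, A `<=` B -> P B -> P A) ->
  (forall A B, P A -> P B -> P (A `|` B)) ->
  (forall x, K x -> exists2 V, nbhs x V & P (V `&` K)) -> P K.
Proof.
move=> Kc P0 Psub PU Ploc; apply: contrapT => nPK.
pose F : set_system T := [set A | P (K `\` A)].
have FF : ProperFilter F.
  split; first by rewrite /F /= setD0.
  split; first by rewrite /F /= setDT.
    by move=> A B FA FB; rewrite /F /= setDIr; exact: PU.
  by move=> A B AB; apply: Psub => x [Kx nBx]; split => // /AB.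
have FK : F K by rewrite /F /= setDv.
have [x [Kx clx]] := Kc F FF FK.
have [V Vx PV] := Ploc x Kx.
have FV : F (~` V) by rewrite /F /= setDE setCK setIC.
by have [y []] := clx _ _ FV Vx.
Qed.

(** Without a minimizer, each point of [K] has a neighbourhood where [f] exceeds some [f y] with [y]
    in [K]. Cover induction keeps the smaller of two such values, and on all of [K] it yields
    [f y < f y]. *)
Lemma compact_attains (R : realType) (T : topologicalType) (K : set T)
    (f : T -> \bar R) :
  compact K -> K !=set0 ->
  (forall x y, K x -> f y < f x ->
     exists2 V, nbhs x V & forall z, K z -> V z -> f y < f z) ->
  exists2 x, K x & forall z, K z -> f x <= f z.
Proof.
move=> Kc [k Kk] flsc; apply: contrapT => nmin.
pose P A := exists2 y, K y & forall z, K z -> A z -> f y < f z.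
suff [y Ky /(_ y Ky Ky)] : P K by rewrite ltxx.
apply: compact_cover_ind => //.
- by exists k.
- by move=> A B AB [y Ky yB]; exists y => // z Kz /AB; exact: yB.
- move=> A B [y Ky yA] [z Kz zB].
  have [yz|zy] := leP (f y) (f z).
    exists y => // w Kw [|/(zB w Kw)]; first exact: yA.
    exact: le_lt_trans.
  exists z => // w Kw [/(yA w Kw)|]; last exact: zB.
  exact: lt_trans.
- move=> x Kx.
  have [y Ky yx] : exists2 y, K y & f y < f x.
    apply: contrapT => nyx; apply: nmin; exists x => // z Kz.
    by rewrite leNgt; apply/negP => zx; apply: nyx; exists z.
  have [V Vx VP] := flsc x y Kx yx.
  by exists V => //; exists y => // z Kz [Vz _]; exact: VP.
Qed.

(** * Convex sets and the alternative for two convex functions *)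

Lemma convex_setP (R : realType) (E : lmodType R) (A : set E) :
  @convex_set R E A <->
  forall x y (t : R), (0 <= t <= 1)%R -> A x -> A y ->
    A (t *: x + (1 - t) *: y)%R.
Proof.
split=> [cA x y t /andP[t0 t1] Ax Ay|cA x y t /set_mem Ax /set_mem Ay].
  by have := cA x y (Itv01 t0 t1) (mem_set Ax) (mem_set Ay); rewrite inE.
apply/mem_set; apply: (cA x y t%:num) => //.
by apply/andP; split; [exact: ge0|exact: le1].
Qed.

(* The admissible weights [t] form an interval; the lower bounds come from the
   points where [g < 0], the upper ones from those where [f < 0], and if a
   lower bound exceeded an upper one then both functions would be negative
   somewhere on the segment joining the two points. *)
Lemma convex_alternative2 (R : realType) (E : lmodType R) (K : set E)
    (f g : E -> R) :
  @convex_set R E K ->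
  (forall x y t, K x -> K y -> 0 <= t <= 1 ->
     f (t *: x + (1 - t) *: y) <= t * f x + (1 - t) * f y)%R ->
  (forall x y t, K x -> K y -> 0 <= t <= 1 ->
     g (t *: x + (1 - t) *: y) <= t * g x + (1 - t) * g y)%R ->
  (forall x, K x -> 0 <= f x \/ 0 <= g x)%R ->
  exists2 t : R, (0 <= t <= 1)%R &
    forall x, K x -> (0 <= t * f x + (1 - t) * g x)%R.
Proof.
move=> /convex_setP cK cf cg fg.
(* The quotient solves [t * f x + (1 - t) * g x = 0] for [t]; the extra element [0] keeps [L]
   non-empty and [sup L] nonnegative. *)
pose L : set R := [set u | u = 0%R \/
  exists2 x, K x /\ (g x < 0)%R & u = (- g x / (f x - g x))%R].
have pos x : K x -> (g x < 0)%R -> (0 <= f x)%R.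
  by move=> Kx gx; case: (fg x Kx) => //; rewrite leNgt gx.
have pos' x : K x -> (f x < 0)%R -> (0 <= g x)%R.
  by move=> Kx gx; case: (fg x Kx) => //; rewrite leNgt gx.
have L1 : ubound L 1%R.
  move=> u [->|[x [Kx gx] ->]]; first exact: ler01.
  have fx := pos x Kx gx.
  by rewrite ler_pdivrMr; lra.
have L0 : L 0%R by left.
have Lsup : has_sup L by split; [exists 0%R|exists 1%R].
exists (sup L) => [|x Kx].
  by rewrite (ub_le_sup (proj2 Lsup) L0)/=; apply: ge_sup => //; exists 0%R.
have [fx0|fx0] := ltP (f x) 0%R.
  have gx0 := pos' x Kx fx0.
  suff : (sup L <= g x / (g x - f x))%R by rewrite ler_pdivlMr; lra.
  apply: ge_sup; first by exists 0%R.
  move=> u [->|[y [Ky gy0] ->]]; first by rewrite divr_ge0//; lra.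
  have fy0 := pos y Ky gy0.
  rewrite ler_pdivrMr; last lra.
  rewrite mulrAC ler_pdivlMr; last lra.
  rewrite leNgt; apply/negP => cross.
  have D0 : (0 < (f y - g y) + (g x - f x))%R by lra.
  (* At this weight the chords of [f] and [g] from [x] to [y] meet; [cross] says exactly that their
     common value is negative. *)
  pose t : R := ((g x - f x) / ((f y - g y) + (g x - f x)))%R.
  have t01 : (0 <= t <= 1)%R.
    by rewrite /t divr_ge0/= ?ler_pdivrMr//; lra.
  have tE : (t * ((f y - g y) + (g x - f x)) = g x - f x)%R.
    by rewrite /t divfK// gt_eqF.
  have cft := cf y x t Ky Kx t01; have cgt := cg y x t Ky Kx t01.
  have ft : (t * f y + (1 - t) * f x < 0)%R.
    rewrite -(pmulr_llt0 _ D0).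
    have -> : ((t * f y + (1 - t) * f x) * (f y - g y + (g x - f x)) =
      (t * (f y - g y + (g x - f x))) * (f y - f x) +
      f x * (f y - g y + (g x - f x)))%R by ring.
    by rewrite tE; lra.
  have gt : (t * g y + (1 - t) * g x < 0)%R.
    rewrite -(pmulr_llt0 _ D0).
    have -> : ((t * g y + (1 - t) * g x) * (f y - g y + (g x - f x)) =
      (t * (f y - g y + (g x - f x))) * (g y - g x) +
      g x * (f y - g y + (g x - f x)))%R by ring.
    by rewrite tE; lra.
  by case: (fg _ (cK y x t t01 Ky Kx)); lra.
have [gx0|gx0] := ltP (g x) 0%R; last first.
  have /andP[s0 s1] : (0 <= sup L <= 1)%R.
    by rewrite (ub_le_sup (proj2 Lsup) L0)/=; apply: ge_sup => //; exists 0%R.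
  by rewrite addr_ge0// mulr_ge0// subr_ge0.
have : (- g x / (f x - g x) <= sup L)%R.
  by apply: ub_le_sup; [exact: (proj2 Lsup)|right; exists x].
by rewrite ler_pdivrMr; lra.
Qed.

Lemma ereal_dense (R : realType) (x y : \bar R) :
  x < y -> exists2 r : R, x < r%:E & r%:E < y.
Proof.
case: x => [x| |]; case: y => [y| |] //; rewrite ?lte_fin => xy.
- by exists ((x + y) / 2)%R; rewrite lte_fin; lra.
- by exists (x + 1)%R; rewrite ?ltry// lte_fin; lra.
- by exists (y - 1)%R; rewrite ?ltNyr// lte_fin; lra.
- by exists 0%R; rewrite ?ltry ?ltNyr.
Qed.

Lemma continuous_lincomb (R : realType) (T : topologicalType) (f g : T -> R^o)
    (a b : R) :
  continuous f -> continuous g -> continuous (fun z => a * f z + b * g z : R^o)%R.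
Proof.
by move=> cf cg z; apply: (@cvgD _ R^o);
  apply: cvgMl_tmp; [exact: cf|exact: cg].
Qed.

(** * Convex hulls of sets and of extended-real functions *)

Section ConvexHulls.
Variables (R : realType) (E : lmodType R).
Implicit Types (f h : E -> \bar R) (A : set E).

Lemma conv_fun_le f x : conv_fun f x <= f x.
Proof. by apply: ge_ereal_sup => _ [h [_ hf] <-]. Qed.

Lemma le_conv_fun f h x :
  econvex h -> (forall y, h y <= f y) -> h x <= conv_fun f x.
Proof. by move=> ch hf; apply: ereal_sup_ubound; exists h. Qed.

(** Jensen's inequality through real upper bounds, so that opposite infinities are never added. *)
Lemma econvexP f : econvex f <->
  forall x y (r u t : R), (0 <= t <= 1)%R -> f x <= r%:E -> f y <= u%:E ->
    f (t *: x + (1 - t) *: y)%R <= (t * r + (1 - t) * u)%:E.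
Proof.
split=> [/convex_setP cf x y r u t t01 fx fy|cf].
  exact: (cf (x, r) (y, u) t t01 fx fy).
by apply/convex_setP => -[x r] [y u] t t01 /= fx fy; exact: cf.
Qed.

Lemma econvex_conv_fun f : econvex (conv_fun f).
Proof.
apply/econvexP => x y r u t t01 fx fy; apply: ge_ereal_sup => _ [h [ch hf] <-].
by apply: (proj1 (econvexP h) ch) => //;
  [apply: le_trans fx|apply: le_trans fy]; exact: le_conv_fun.
Qed.

Lemma convex_conv_set A : @convex_set R E (conv_set A).
Proof.
apply/convex_setP => x y t t01 Ax Ay B AB.
have [/convex_setP cB _] := AB.
by apply: cB => //; [exact: Ax|exact: Ay].
Qed.

Lemma sub_conv_set A : A `<=` conv_set A.
Proof. exact: sub_smallest. Qed.

(** The effective domain of a convex function is convex; the value [-oo] remains possible on it. *)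
Lemma econvex_lty_conv_set f A : econvex f ->
  (forall x, A x -> f x < +oo) -> forall x, conv_set A x -> f x < +oo.
Proof.
move=> /econvexP cf fA.
apply: (@smallest_sub _ _ A [set x | f x < +oo]) => //.
have bound x : f x < +oo -> exists r : R, f x <= r%:E.
  by move=> /ereal_dense[r fr _]; exists r; exact: ltW.
apply/convex_setP => x y t t01 /= /bound[r fx] /bound[u fy].
by apply: le_lt_trans (cf _ _ _ _ _ t01 fx fy) _; rewrite ltry.
Qed.

End ConvexHulls.

(** * The pairing and its weak topology *)

Section DualSystem.
Variables (R : realType) (X Y : lmodType R) (br : {bilinear X -> Y -> R^o}).
Local Notation Z := (X * Y)%type.
Local Notation dot := (dot br).
Local Notation cpl := (cpl br).
Implicit Types (z w g s : Z) (B G S : set Z).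

Lemma dotC z w : dot z w = dot w z.
Proof. by rewrite /Defs.dot addrC. Qed.

Lemma dotDl z1 z2 w (t : R) :
  dot (t *: z1 + (1 - t) *: z2)%R w = (t * dot z1 w + (1 - t) * dot z2 w)%R.
Proof.
rewrite /Defs.dot /= linearDl linearDr !linearZl_LR !linearZr_LR /=.
rewrite /GRing.scale /=; ring.
Qed.

Lemma dotDr z w1 w2 (t : R) :
  dot z (t *: w1 + (1 - t) *: w2)%R = (t * dot z w1 + (1 - t) * dot z w2)%R.
Proof. by rewrite dotC dotDl !(dotC z). Qed.

Lemma cplB z w : cpl (z - w)%R = (cpl z + cpl w - dot z w)%R.
Proof.
by rewrite /Defs.cpl /Defs.dot /= linearBl !linearBr /=; ring.
Qed.

Lemma dotxx z : dot z z = (cpl z + cpl z)%R.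
Proof. by []. Qed.

(** On a dissipative set the last term has the sign that makes [- cpl] convex along segments. *)
Lemma cpl_conv z w (t : R) : cpl (t *: z + (1 - t) *: w)%R =
  (t * cpl z + (1 - t) * cpl w - t * (1 - t) * cpl (z - w))%R.
Proof.
rewrite cplB /Defs.cpl /Defs.dot /= linearDl !linearDr !linearZl_LR !linearZr_LR.
rewrite /GRing.scale /=; ring.
Qed.

Lemma continuous_dot B b : B b ->
  continuous (fun z : sigma_topology br B => dot z b : R^o).
Proof.
move=> Bb z.
have bB : b \in B by rewrite inE.
have /cvg_sup/(_ (SigSub bB)) cz :
  nbhs (z : sigma_topology br B) --> (z : sigma_topology br B) by exact: cvg_id.
exact: cvg_comp cz (@initial_continuous _ _ (fun z => dot z b : R^o) z).
Qed.

Lemma continuous_dot_conv B G g : G `<=` B -> conv_set G g ->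
  continuous (fun z : sigma_topology br B => dot z g : R^o).
Proof.
move=> GB; move: g; apply: (@smallest_sub _ _ G [set g |
  continuous (fun z : sigma_topology br B => dot z g : R^o)]); last first.
  by move=> g Gg; apply: continuous_dot; exact: GB.
apply/convex_setP => x y t _ /= cx cy.
rewrite (_ : (fun _ => _) = fun z : sigma_topology br B =>
    (t * dot z x + (1 - t) * dot z y)%R : R^o); last first.
  by apply/funext => w; rewrite dotDr.
exact: (@continuous_lincomb _ (sigma_topology br B)).
Qed.

(** * The gap functions and their minimax property *)

(** Meant for [p = (g, r)] in the epigraph of the convex hull of [cpl_on]; keeping [r] as a separate
    coordinate makes [gap] affine in [p]. *)
Definition gap (p : Z * R^o) s : R := (dot s p.1 - p.2 - cpl s)%R.

Lemma gap_conv p q s (t : R) : gap (t *: p + (1 - t) *: q)%R s =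
  (t * gap p s + (1 - t) * gap q s)%R.
Proof. by rewrite /gap /= dotDr /GRing.scale /=; ring. Qed.

Lemma gap_convex S p x y (t : R) : dissipative br S -> S x -> S y ->
  (0 <= t <= 1)%R ->
  (gap p (t *: x + (1 - t) *: y) <= t * gap p x + (1 - t) * gap p y)%R.
Proof.
move=> Sd Sx Sy /andP[t0 t1]; rewrite /gap dotDl cpl_conv.
have : (t * (1 - t) * cpl (x - y) <= 0)%R.
  by rewrite mulr_ge0_le0 ?mulr_ge0 ?subr_ge0// Sd.
lra.
Qed.

(* On a dissipative [S] one has [- c(z) = sup_(s in S) (c(s) - z . s)], with
   equality at [s = z]; hence [- c] is lower semicontinuous along [S] although
   [c] need not be continuous. *)
Lemma gap_lsc B S p x (a : R) : dissipative br S -> S `<=` B ->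
  continuous (fun z : sigma_topology br B => dot z p.1 : R^o) ->
  S x -> (a < gap p x)%R ->
  exists2 V, nbhs (x : sigma_topology br B) V &
    forall z, S z -> V z -> (a < gap p z)%R.
Proof.
move=> Sd SB cp Sx ax.
(* By dissipativity [gap p z >= h z - p.2 + cpl x] on [S], with equality at [z = x]. *)
pose h (z : sigma_topology br B) : R^o := (dot z p.1 - dot z x)%R.
have ch : continuous h.
  rewrite (_ : h = fun z => (1 * dot z p.1 + -1 * dot z x)%R); last first.
    by apply/funext => z; rewrite mul1r mulN1r.
  by apply: (@continuous_lincomb _ (sigma_topology br B)) => //;
    apply: continuous_dot; exact: SB.
exists (h @^-1` [set u | a + p.2 - cpl x < u]%R).
  apply: ch; apply: open_nbhs_nbhs; split; first exact: open_gt.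
  by move: ax; rewrite /h /gap /= dotxx; lra.
move=> z Sz /=; rewrite /h /gap.
by have := Sd _ _ Sz Sx; rewrite cplB; lra.
Qed.

(* The cover induction proves that [A] is removable: a bound valid on every
   convex part of [S] avoiding [A] can be turned into one valid across [A].
   For open [A] on which one function of the family is large this is the
   alternative for two convex functions. *)
Lemma gap_minimax B S (P : set (Z * R^o)) (lam : R) :
  dissipative br S -> @convex_set R Z S -> S `<=` B ->
  sigma_compact br B S -> @convex_set R (Z * R^o)%type P -> P !=set0 ->
  (forall s, S s -> exists p, [/\ P p, B p.1 & (lam < gap p s)%R]) ->
  exists2 p, P p & forall s, S s -> (lam <= gap p s)%R.
Proof.
move=> Sd Sc SB Sk /convex_setP Pc [p0 Pp0] PS.
pose bounded K := exists2 p, P p & forall s, K s -> (lam <= gap p s)%R.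
pose removable A := forall K, @convex_set R Z K -> K `<=` S ->
  (forall K', @convex_set R Z K' -> K' `<=` K `\` A -> bounded K') -> bounded K.
suff /(_ S Sc (@subset_refl _ S)) : removable S.
  by apply=> K' _; rewrite setDv => K'0; exists p0 => // s /K'0.
apply: (@compact_cover_ind (sigma_topology br B)) => //.
- by move=> K Kc KS; apply => //; rewrite setD0.
- move=> A A' AA' rA' K Kc KS KA; apply: rA' => // K' K'c K'A.
  by apply: KA => // s /K'A[Ks nA's]; split => // /AA'.
(* First [A] is removed from [K], then [A'] from each convex part of [K] outside [A]. *)
- move=> A A' rA rA' K Kc KS KA; apply: rA => // K1 K1c K1A.
  apply: rA' => // [s /K1A[/KS]//|K2 K2c K2A].
  apply: KA => // s /K2A[/K1A[Ks nAs] nA's].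
  by split => // -[].
- move=> x Sx; have [q [Pq Bq qx]] := PS x Sx.
  have [V Vx Vq] := gap_lsc Sd SB (continuous_dot Bq) Sx qx.
  exists V => // K Kc KS KV.
  have cgap p : forall x y (t : R), K x -> K y -> (0 <= t <= 1)%R ->
      (gap p (t *: x + (1 - t) *: y) - lam <=
       t * (gap p x - lam) + (1 - t) * (gap p y - lam))%R.
    move=> y z t Ky Kz t01.
    by have := gap_convex p Sd (KS _ Ky) (KS _ Kz) t01; lra.
  (* This sublevel set is convex and avoids [V], so some [p] is good on it, while [q] is good on the
     rest of [K]; the alternative then merges [p] and [q]. *)
  have [|s [Ks sq]|p Pp pK] := KV [set s | K s /\ (gap q s < lam)%R].
  + apply/convex_setP => y z t t01 [Ky yq] [Kz zq].
    move/convex_setP : Kc => Kc; split; first exact: Kc.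
    have := cgap q _ _ _ Ky Kz t01.
    have /andP[t0 t1] := t01.
    have : (t * (gap q y - lam) + (1 - t) * (gap q z - lam) < 0)%R.
      have [->|tn0] := eqVneq t 0%R; first by lra.
      have tp : (0 < t)%R by rewrite lt_neqAle eq_sym tn0.
      rewrite ltr_wnDr ?pmulr_rlt0 ?mulr_ge0_le0; lra.
    by lra.
  + by split => // -[Vs _]; have := Vq s (KS _ Ks) Vs; lra.
  have [s Ks|t t01 tK] := convex_alternative2 Kc (cgap p) (cgap q).
    have [qs|qs] := ltP (gap q s) lam; [left|right]; last by rewrite subr_ge0.
    by rewrite subr_ge0 pK.
  exists (t *: p + (1 - t) *: q)%R => [|s Ks]; first exact: Pc.
  by have := tK s Ks; rewrite gap_conv; lra.
Qed.

(** * The Fitzpatrick function in terms of gaps *)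

Lemma fitzpatrick_gt G s (lam : R) : lam%:E < fitzpatrick br G s - (cpl s)%:E <->
  exists2 g, G g & (lam < gap (g, cpl g) s)%R.
Proof.
rewrite lteBrDr//; split=> [/ereal_sup_gt[_ [g Gg <-]]|[g Gg lg]].
  by rewrite -EFinD lte_fin => lg; exists g => //; rewrite /gap/=; lra.
apply: (@lt_le_trans _ _ (dot s g - cpl g)%:E).
  by rewrite -EFinD lte_fin; move: lg; rewrite /gap/=; lra.
by apply: ereal_sup_ubound; exists g.
Qed.

(** The left side bounds the supremum over [G] of [gap (g, cpl g) s], which equals
    [- cpl (s - g)]. *)
Lemma fitzpatrick_le0 G s : fitzpatrick br G s - (cpl s)%:E <= 0 <->
  mono_polar br G s.
Proof.
rewrite leeBlDr// add0e; split=> [Gs g Gg|Gs].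
  have : (dot s g - cpl g)%:E <= (cpl s)%:E.
    by apply: le_trans Gs; apply: ereal_sup_ubound; exists g.
  by rewrite lee_fin cplB; lra.
apply: ge_ereal_sup => _ [g Gg <-]; rewrite lee_fin.
by have := Gs g Gg; rewrite cplB; lra.
Qed.

Lemma fitzpatrick_gtNy G s : G !=set0 -> -oo < fitzpatrick br G s.
Proof.
move=> [g Gg]; apply: (@lt_le_trans _ _ (dot s g - cpl g)%:E).
  by rewrite ltNyr.
by apply: ereal_sup_ubound; exists g.
Qed.

(* If [fitzpatrick G s] is a real [l], then [z |-> s . z - l] is an affine
   minorant of [c_G], hence of its convex hull. *)
Lemma gap_le_fitzpatrick G s g (r : R) : G !=set0 ->
  conv_fun (cpl_on br G) g <= r%:E ->
  (gap (g, r) s)%:E <= fitzpatrick br G s - (cpl s)%:E.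
Proof.
move=> G0; have := fitzpatrick_gtNy s G0.
case Fs : (fitzpatrick br G s) => [l| |]// _; last by rewrite leey.
move=> gr; have /le_trans/(_ gr) : (dot s g - l)%:E <= conv_fun (cpl_on br G) g.
  apply: (@le_conv_fun _ _ (cpl_on br G) (fun z => (dot s z - l)%:E)) => [|z].
    apply/econvexP => x y u v t /andP[t0 t1]; rewrite !lee_fin => xu yv.
    rewrite dotDr.
    have := ler_wpM2l t0 xu; have : (0 <= 1 - t)%R by lra.
    by move/ler_wpM2l/(_ _ _ yv); lra.
  rewrite /cpl_on; case: ifPn => [/set_mem Gz|_]; last by rewrite leey.
  have : (dot s z - cpl z)%:E <= l%:E.
    by rewrite -Fs; apply: ereal_sup_ubound; exists z.
  by rewrite !lee_fin; lra.
by rewrite -EFinB !lee_fin /gap/=; lra.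
Qed.

End DualSystem.

(** * The minimax formula and the equivalences *)

Theorem theorem8 (R : realType) (X Y : lmodType R)
    (br : {bilinear X -> Y -> R^o}) (G S : set (X * Y))
    (G_nonempty : G !=set0) (S_nonempty : S !=set0)
    (S_dissipative : dissipative br S)
    (S_convex : @convex_set R (X * Y)%type S)
    (S_compact : sigma_compact br (G `|` S) S) :
  let c : X * Y -> \bar R := fun z => (cpl br z)%:E in
  let dotE : X * Y -> X * Y -> \bar R := fun z w => (dot br z w)%:E in
  let cc : X * Y -> \bar R := conv_fun (cpl_on br G) in
  let F : X * Y -> \bar R := fun s => fitzpatrick br G s - c s in
  let H : X * Y -> X * Y -> \bar R := fun g s => dotE s g - cc g - c s in
  let cond1 := mono_polar br G `&` S !=set0 in
  let cond2 := [/\ attains_min S F, inf_on S F \is a fin_num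
                 & inf_on S F <= 0] in
  let cond3 := forall g, conv_set G g -> exists2 s, S s &
      (cc g - c g) + c (g - s)%R = cc g + c s - dotE s g
      /\ 0 <= cc g + c s - dotE s g in
  [/\ attains_min S F,
      forall g, conv_set G g -> attains_min S (H g),
      inf_on S F = ereal_sup [set inf_on S (H g) | g in conv_set G],
      (cond1 <-> cond2) &
      (cond2 <-> cond3)].
Proof.
move=> c dotE cc F H cond1 cond2 cond3.
have SB : S `<=` G `|` S by right.
have GB : G `<=` G `|` S by left.
have cc_lty g : conv_set G g -> cc g < +oo.
  apply: econvex_lty_conv_set g; first exact: econvex_conv_fun.
  move=> g Gg; apply: le_lt_trans (conv_fun_le _ _) _.
  by rewrite /cpl_on mem_set// ltry.
have gap_le_F s g r : cc g <= r%:E -> (gap br (g, r) s)%:E <= F s.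
  exact: gap_le_fitzpatrick.
have H_gap s g r : cc g = r%:E -> H g s = (gap br (g, r) s)%:E.
  by move=> gr; rewrite /H gr.
have H_Ny s g : cc g = -oo -> H g s = +oo by move=> gr; rewrite /H gr.
have H_le_F s g : conv_set G g -> H g s <= F s.
  move=> /cc_lty; case gE : (cc g) => [r| |]// _.
    by rewrite (H_gap _ _ _ gE); apply: gap_le_F; rewrite gE.
  rewrite H_Ny// leye_eq; apply/eqP/eq_infty => r.
  (* With [cc g = -oo] every second coordinate is admissible; this one makes the gap equal to the
     arbitrary real [r], forcing [F s = +oo]. *)
  have -> : r = gap br (g, dot br s g - cpl br s - r)%R s by rewrite /gap/=; ring.
  by apply: gap_le_F; rewrite gE leNye.
have gap_le_H s g r : cc g <= r%:E -> (gap br (g, r) s)%:E <= H g s.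
  case gE : (cc g) => [u| |]// ur; last by rewrite H_Ny// leey.
  by rewrite (H_gap _ _ _ gE) lee_fin /gap/=; move: ur; rewrite lee_fin; lra.
have F_gtNy s : -oo < F s by rewrite /F lteBrDr// fitzpatrick_gtNy.
have F_attains : attains_min S F.
  have [s0 Ss0 s0F] : exists2 s0, S s0 & forall s, S s -> F s0 <= F s.
    (* A real level strictly between [F y] and [F x] is exceeded at [x] by the gap of a single [g]
       in [G], which is lower semicontinuous on [S]. *)
    apply: (compact_attains S_compact) => // x y Sx /ereal_dense[a ya ax].
    have [g Gg agx] := proj1 (fitzpatrick_gt br G x a) ax.
    have cg := continuous_dot (br := br) (GB _ Gg).
    have [V Vx aV] :=
      @gap_lsc _ _ _ br _ _ (g, cpl br g) _ _ S_dissipative SB cg Sx agx.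
    exists V => // z Sz Vz; apply: lt_trans ya _.
    by apply/fitzpatrick_gt; exists g => //; exact: aV.
  by exists s0.
have H_attains g : conv_set G g -> attains_min S (H g).
  move=> Gg; have := cc_lty g Gg; case gE : (cc g) => [r| |]// _; last first.
    (* Here [H g] is constantly [+oo], so any point of [S] is a minimizer. *)
    by have [s Ss] := S_nonempty; exists s => //; split => [|t _]; rewrite !H_Ny.
  have [s0 Ss0 s0H] : exists2 s0, S s0 & forall s, S s -> H g s0 <= H g s.
    apply: (compact_attains S_compact) => // x y Sx.
    rewrite !(H_gap _ _ _ gE) lte_fin => yx.
    have [V Vx aV] := @gap_lsc _ _ _ br _ _ (g, r) _ _ S_dissipative SB
      (continuous_dot_conv (br := br) GB Gg) Sx yx.
    by exists V => // z Sz Vz; rewrite (H_gap _ _ _ gE) lte_fin; exact: aV.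
  by exists s0 => //; split => //; rewrite (H_gap _ _ _ gE) ltNyr.
have inf_attained f s0 : S s0 -> (forall s, S s -> f s0 <= f s) ->
    inf_on S f = f s0.
  move=> Ss0 fs0; apply/eqP; rewrite eq_le; apply/andP; split.
    by apply: ereal_inf_lbound; exists s0.
  by apply: le_ereal_inf_tmp => _ [s Ss <-]; exact: fs0.
have [s0 Ss0 [Fs0 s0F]] := F_attains.
have infF : inf_on S F = F s0 by exact: inf_attained.
have minimax : inf_on S F = ereal_sup [set inf_on S (H g) | g in conv_set G].
  apply/eqP; rewrite eq_le; apply/andP; split; last first.
    apply: ge_ereal_sup => _ [g Gg <-]; rewrite infF.
    by apply: le_trans (H_le_F s0 g Gg); apply: ereal_inf_lbound; exists s0.
  rewrite leNgt; apply/negP => /ereal_dense[lam supl]; rewrite infF => lF.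
  (* The epigraph of [cc] over the convex hull of [G]: the pairs [(g, cpl br g)] supply the
     pointwise witnesses, and the merged point still bounds [cc] from above. *)
  pose P : set (X * Y * R^o) :=
    [set p | conv_set G p.1 /\ cc p.1 <= (p.2 : R)%:E].
  have P_G g : G g -> P (g, cpl br g).
    move=> Gg; split; first exact: sub_conv_set.
    by apply: le_trans (conv_fun_le _ _) _; rewrite /cpl_on mem_set.
  have P_convex : @convex_set R (X * Y * R^o)%type P.
    apply/convex_setP => -[x r] [y u] t t01 [/= Gx xr] [/= Gy yu]; split => /=.
      exact: (proj1 (convex_setP _) (@convex_conv_set _ _ G)).
    exact: (proj1 (econvexP _) (@econvex_conv_fun _ _ (cpl_on br G))).
  have P_nonempty : P !=set0.
    by have [g Gg] := G_nonempty; exists (g, cpl br g); exact: P_G.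
  have [s Ss|[g r] [/= Gg gr] lamg] := gap_minimax (lam := lam)
    S_dissipative S_convex SB S_compact P_convex P_nonempty.
    have /fitzpatrick_gt[g Gg gs] := lt_le_trans lF (s0F s Ss).
    by exists (g, cpl br g); split => //; [exact: P_G|exact: GB].
  move: supl; rewrite ltNge => /negP; apply.
  apply: (@le_trans _ _ (inf_on S (H g))); last first.
    by apply: ereal_sup_ubound; exists g.
  apply: le_ereal_inf_tmp => _ [s Ss <-].
  by apply: le_trans (gap_le_H s g r gr); rewrite lee_fin lamg.
(* If [cc g = -oo], both sides are false: [H g s] is [+oo] and the right-hand sum is [-oo]. *)
have H_le0 g s : conv_set G g -> H g s <= 0 <-> 0 <= cc g + c s - dotE s g.
  move=> /cc_lty; rewrite /H /c /dotE; case: (cc g) => [r| |]//= _.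
  by rewrite !lee_fin; split; lra.
split => //; split.
- move=> [s [Gs Ss]]; split => //.
    rewrite infF fin_numElt Fs0/=; apply: le_lt_trans (s0F s Ss) _.
    by apply: (@le_lt_trans _ _ 0); rewrite ?ltry//; apply/fitzpatrick_le0.
  by rewrite infF; apply: le_trans (s0F s Ss) _; apply/fitzpatrick_le0.
- move=> [_ _]; rewrite infF => F0.
  by exists s0; split => //; apply/fitzpatrick_le0.
(* The minimizer [s0] of [F] serves every [g] at once. *)
- move=> [_ _]; rewrite infF => F0 g Gg; exists s0 => //; split.
    have := cc_lty g Gg; rewrite /c /dotE cplB dotC.
    by case: (cc g) => [r| |]//= _; congr EFin; ring.
  by apply/H_le0 => //; apply: le_trans F0; exact: H_le_F.
- move=> c3.
  (* Condition (3) makes every inner minimum nonpositive; the minimax formula carries this over to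
     [F]. *)
  have inf_le0 : inf_on S F <= 0.
    rewrite minimax; apply: ge_ereal_sup => _ [g Gg <-].
    have [s Ss [_ /H_le0 - /(_ Gg)]] := c3 g Gg.
    by apply: le_trans; apply: ereal_inf_lbound; exists s.
  split => //; rewrite fin_numElt (le_lt_trans inf_le0) ?ltry//.
  by rewrite infF Fs0.
Qed.
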